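(* Let $\varphi(s)=s+c_1$ with $c_1\in\mathbb C$, $\mathrm{Re}(c_1)\ge0$, $c_1\ne0$. Then the composition operator $C_\varphi$ on $\mathcal H^2$ has a minimal commutant if and only if $c_1$ is not of the form $c_1=i\tau$ with $\tau=2k\pi/\log(m_0/n_0)$ for some $k\in\mathbb Z\setminus\{0\}$ and integers $m_0,n_0\ge1$, $m_0\ne n_0$.
   Context: $\mathcal H^2$ is the Hilbert space of Dirichlet series $f(s)=\sum_{n\ge1}a_nn^{-s}$ with $\|f\|=(\sum|a_n|^2)^{1/2}<\infty$ (analytic on $\{\mathrm{Re}\,s>1/2\}$), and $C_\varphi f=f\circ\varphi$. For a bounded operator $A$ on a Hilbert space $H$, $\{A\}'=\{T\in\mathcal B(H):TA=AT\}$, $\mathrm{alg}(A)=\{p(A):p\text{ a polynomial}\}$, and $A$ has a minimal commutant if $\overline{\mathrm{alg}(A)}^{\sigma}=\{A\}'$, where $\sigma$ denotes the weak operator topology. *)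

(* Defs.v *)
From HB Require Import structures.
From mathcomp Require Import all_boot all_order all_algebra.
From mathcomp Require Import all_classical all_reals all_analysis.
From mathcomp.real_closed Require Import complex.
From mathcomp Require Import ring.

Set Implicit Arguments.
Unset Strict Implicit.
Unset Printing Implicit Defensive.

Import Order.TTheory GRing.Theory Num.Theory Normc.
Import numFieldNormedType.Exports.

Local Open Scope classical_set_scope.
Local Open Scope ring_scope.
Local Open Scope complex_scope.

(* The limit is taken for the norm topology of the field of complex numbers;
   it is meaningful only for convergent series. *)
Definition csum (R : realType) (a : nat -> R[i]) : R[i] :=
  limn (series (a : nat -> R[i]^o)).

Definition cexp (R : realType) (z : R[i]) : R[i] :=
  (expR (complex.Re z))%:C * (cos (complex.Im z) +i* sin (complex.Im z)).

Definition natcpow (R : realType) (n : nat) (s : R[i]) : R[i] :=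
  cexp (s * (ln n%:R)%:C).

Definition square_summable (R : realType) : {pred nat -> R[i]} :=
  [pred a | `[< cvgn (series (fun n => normc (a n) ^+ 2)) >]].
Arguments square_summable : clear implicits.

Section SquareSummable.
Variable R : realType.
Implicit Types a : nat -> R[i].

Lemma square_summableP a : reflect
  (exists M : R, forall n, \sum_(0 <= k < n) normc (a k) ^+ 2 <= M)
  (a \in square_summable R).
Proof.
apply: (iffP (asboolP _)) => [cva|[M aM]].
  exists (limn (series (fun n => normc (a n) ^+ 2))) => n.
  apply: (nondecreasing_cvgn_le _ cva).
  by apply: nondecreasing_series => k _ _; rewrite sqr_ge0.
apply: nondecreasing_is_cvgn.
  by apply: nondecreasing_series => n _ _; rewrite sqr_ge0.
by exists M => _ [n _ <-]; exact: aM.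
Qed.

Lemma normc_sqE (z : R[i]) :
  normc z ^+ 2 = complex.Re z ^+ 2 + complex.Im z ^+ 2.
Proof. by case: z => x y /=; rewrite sqr_sqrtr ?addr_ge0 ?sqr_ge0. Qed.

Lemma square_summable_submod_closed : submod_closed (square_summable R).
Proof.
split.
  apply/square_summableP; exists 0 => n.
  by rewrite big1 // => k _; rewrite normc0 expr0n.
move=> c a b /square_summableP[M aM] /square_summableP[N bN].
apply/square_summableP.
exists (2 * (normc c ^+ 2 * M) + 2 * N) => n.
apply: (@le_trans _ _ (\sum_(0 <= k < n)
    (2 * (normc c ^+ 2 * normc (a k) ^+ 2) + 2 * normc (b k) ^+ 2))); last first.
  rewrite big_split /= -!mulr_sumr lerD // ler_wpM2l //.
  by rewrite ler_wpM2l ?sqr_ge0.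
apply: ler_sum => k _.
have -> : (c *: a + b) k = c * a k + b k by [].
rewrite -exprMn -normcM !normc_sqE; case: (c * a k) => x y; case: (b k) => u v /=.
rewrite -subr_ge0.
have -> : 2 * (x ^+ 2 + y ^+ 2) + 2 * (u ^+ 2 + v ^+ 2) -
  ((x + u) ^+ 2 + (y + v) ^+ 2) = (x - u) ^+ 2 + (y - v) ^+ 2.
  by ring.
by rewrite addr_ge0 ?sqr_ge0.
Qed.

HB.instance Definition _ := GRing.isSubmodClosed.Build _ _ (square_summable R)
  square_summable_submod_closed.

End SquareSummable.

(* The element f represents the Dirichlet series \sum_(n >= 1) a_n n^(-s) with
   an index shift: f n is the coefficient a_(n+1). *)
Record hardy (R : realType) := Hardy {
  coef :> nat -> R[i];
  coef_square_summable : coef \in square_summable R }.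

Section HardyLmodule.
Variable R : realType.
HB.instance Definition _ := [isSub for @coef R].
HB.instance Definition _ := [Choice of hardy R by <:].
HB.instance Definition _ := [SubChoice_isSubLmodule of hardy R by <:].
End HardyLmodule.

Definition dirichlet (R : realType) (f : hardy R) (s : R[i]) : R[i] :=
  csum (fun n => f n * natcpow n.+1 (- s)).

Definition hnorm (R : realType) (f : hardy R) : R :=
  Num.sqrt (limn (series (fun n => normc (f n) ^+ 2))).

Definition hdot (R : realType) (f g : hardy R) : R[i] :=
  csum (fun n => f n * (g n)^*).

Record bounded_operator (R : realType) := BoundedOperator {
  operator :> {linear hardy R -> hardy R};
  operator_bounded : exists M : R, forall f, hnorm (operator f) <= M * hnorm f }.

HB.instance Definition _ (R : realType) := gen_eqMixin (bounded_operator R).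
HB.instance Definition _ (R : realType) := gen_choiceMixin (bounded_operator R).

(* The weak operator topology is the coarsest one for which all the maps
   T |-> <T f, g> are continuous. *)
Definition wot (R : realType) : topologicalType :=
  initial_topology (fun T : bounded_operator R =>
    (fun fg => hdot (T fg.1) fg.2) : {ptws hardy R * hardy R -> R[i]^o}).

Definition commutant (R : realType) (A : bounded_operator R) :
    set (bounded_operator R) :=
  [set T | forall f, T (A f) = A (T f)].

Definition alg (R : realType) (A : bounded_operator R) :
    set (bounded_operator R) :=
  [set T | exists p : {poly R[i]},
    forall f, T f = \sum_(k < size p) p`_k *: iter k A f].

Definition has_minimal_commutant (R : realType) (A : bounded_operator R) : Prop :=
  closure (alg A : set (wot R)) = commutant A.

Section CompositionOperator.
Variable R : realType.

Definition is_composition_operator (phi : R[i] -> R[i])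
    (T : bounded_operator R) : Prop :=
  forall (f : hardy R) (s : R[i]), 2^-1 < complex.Re s ->
    dirichlet (T f) s = dirichlet f (phi s).

Lemma id_bounded : exists M : R, forall f : hardy R,
  hnorm (idfun f) <= M * hnorm f.
Proof. by exists 1 => f; rewrite mul1r. Qed.

(* The identity is a dummy value, for the maps phi that do not induce a bounded
   composition operator. *)
Definition composition_operator (phi : R[i] -> R[i]) : bounded_operator R :=
  xget (BoundedOperator id_bounded) [set T | is_composition_operator phi T].

Lemma cexpD (z w : R[i]) : cexp (z + w) = cexp z * cexp w.
Proof.
case: z w => [x y] [u v]; rewrite /cexp /= expRD cosD sinD.
by apply/eqP; rewrite eq_complex /=; apply/andP; split; apply/eqP; ring.
Qed.

Lemma normc_cexp (z : R[i]) : normc (cexp z) = expR (complex.Re z).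
Proof.
case: z => x y; rewrite /cexp /= !mul0r subr0 addr0 !exprMn -mulrDr.
by rewrite cos2Dsin2 mulr1 sqrtr_sqr ger0_norm ?expR_ge0.
Qed.

Lemma natcpowD (n : nat) (s t : R[i]) :
  natcpow n (s + t) = natcpow n s * natcpow n t.
Proof. by rewrite /natcpow mulrDl cexpD. Qed.

Lemma normc_natcpowN_le1 (n : nat) (c : R[i]) : 0 <= complex.Re c ->
  normc (natcpow n.+1 (- c)) <= 1.
Proof.
move=> c_ge0; rewrite /natcpow normc_cexp; case: c c_ge0 => x y /= x0.
rewrite mulr0 subr0 -[leRHS]expR0 ler_expR mulNr oppr_le0 mulr_ge0 //.
by rewrite ln_ge0 // ler1n.
Qed.

Section Translation.
Variables (c : R[i]) (c_ge0 : 0 <= complex.Re c).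

Let shift (a : nat -> R[i]) : nat -> R[i] :=
  fun n => a n * natcpow n.+1 (- c).

Let shift_le (a : nat -> R[i]) (n : nat) :
  normc (shift a n) ^+ 2 <= normc (a n) ^+ 2.
Proof.
rewrite /shift normcM exprMn ler_piMr ?sqr_ge0 //.
rewrite exprn_ile1 ?normc_natcpowN_le1 //.
by case: (natcpow _ _) => x y /=; exact: sqrtr_ge0.
Qed.

Let shift_summable (f : hardy R) : shift f \in square_summable R.
Proof.
have /square_summableP[M fM] := coef_square_summable f.
apply/square_summableP; exists M => n.
by apply: le_trans (fM n); apply: ler_sum => k _; exact: shift_le.
Qed.

Let shift_fun (f : hardy R) : hardy R := Hardy (shift_summable f).

Let shift_linear : linear shift_fun.
Proof.
move=> z f g; apply: val_inj; apply/funext => n /=.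
by rewrite /shift /= mulrDl -mulrA.
Qed.

HB.instance Definition _ :=
  GRing.isLinear.Build R[i] (hardy R) (hardy R) _ shift_fun shift_linear.

Let shift_bounded : exists M : R, forall f, hnorm (shift_fun f) <= M * hnorm f.
Proof.
exists 1 => f; rewrite mul1r /hnorm ler_wsqrtr //.
have cv (g : hardy R) : cvgn (series (fun n => normc (g n) ^+ 2)).
  exact/asboolP/coef_square_summable.
apply: ler_lim; [exact: cv (shift_fun f)|exact: cv|].
by apply: nearW => n; apply: ler_sum => k _; exact: shift_le.
Qed.

Lemma composition_operator_translationP :
  is_composition_operator (fun s => s + c)
    (composition_operator (fun s => s + c)).
Proof.
apply: (@xgetPex _ (BoundedOperator id_bounded)
  [set T | is_composition_operator (fun s => s + c) T]).
exists (BoundedOperator shift_bounded) => f s _.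
congr csum; apply/funext => n /=.
by rewrite /shift -mulrA -natcpowD -opprD [c + s]addrC.
Qed.

End Translation.

End CompositionOperator.

(* Main.v *)
Require Import Defs.
From HB Require Import structures.
From mathcomp Require Import all_boot all_order all_algebra.
From mathcomp Require Import all_classical all_reals all_analysis.
From mathcomp.real_closed Require Import complex.
From mathcomp Require Import ring lra.

(** On coefficients, composition with the translation by [c1] is the diagonal
    operator [A] with eigenvalues [l n = (n + 1) ^ (- c1)] ([translationE]);
    this rests on the uniqueness of the coefficients of a Dirichlet series
    ([dirichlet_inj]). The arithmetic condition of the theorem says exactly that
    two of these eigenvalues coincide ([natcpowN_injP]). What remains is that a
    diagonal operator with nonzero eigenvalues of nonincreasing modulus has a
    minimal commutant if and only if its eigenvalues are distinct.

    If [l m = l n] with [m != n], then the rank one operator [f |-> f m *: e_n]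
    commutes with [A], but it has a nonzero matrix coefficient off the diagonal,
    whereas the polynomials in [A] and their weak limits are diagonal
    ([minimal_commutant_inj]).

    Conversely, suppose that the eigenvalues are distinct. Weak limits of
    polynomials in [A] commute with [A], and the operators that commute with [A]
    are diagonal ([commutant_diag]), so every diagonal operator has to be
    approximated by polynomials in [A]. By dominated convergence
    ([csum_dominated_cvg]), it suffices that its diagonal be a pointwise limit,
    uniformly bounded, of polynomials evaluated at the [l n]. For the diagonal
    supported at a single index [m], such polynomials are the means
    [(1 + z + ... + z ^ N) / (N + 1)] of the powers of [z = X / l m], as in
    Wiener's theorem on the atoms of a measure on the circle, multiplied by a
    polynomial that vanishes at the finitely many eigenvalues preceding [l m]
    and is 1 at [l m] ([pointwise_approx_delta]). The monotonicity of the moduli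
    makes this argument cover at once the case [0 < Re c1], where the [l n] tend
    to 0, and the case [Re c1 = 0], where they lie on the unit circle. *)

Set Implicit Arguments.
Unset Strict Implicit.
Unset Printing Implicit Defensive.

Import Order.TTheory GRing.Theory Num.Theory Normc.
Import numFieldNormedType.Exports.

Local Open Scope classical_set_scope.
Local Open Scope ring_scope.
Local Open Scope complex_scope.

(** * Complex series *)

Section ComplexSeries.
Variable R : realType.
Implicit Types (u : nat -> R[i]) (l : R[i]).

Lemma normc_ge0 (z : R[i]) : 0 <= normc z.
Proof. by case: z => x y; exact: sqrtr_ge0. Qed.

Lemma normCE (z : R[i]) : `|z| = (normc z)%:C.
Proof. by []. Qed.

Lemma normc_nat n : normc (n%:R : R[i]) = n%:R.
Proof. by apply: complexI; rewrite -normCE normr_nat rmorph_nat. Qed.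

Lemma normcX (z : R[i]) n : normc (z ^+ n) = normc z ^+ n.
Proof. by elim: n => [|n IH]; rewrite ?expr0 ?normc1 // !exprS normcM IH. Qed.

(** The field [R[i]] carries the topology of [R[i]^o], whose radii are complex
    numbers; this reduces its convergent sequences to real null sequences,
    and almost every limit below is taken in that real form. *)
Lemma cvg_normcP u l :
  ((u : nat -> R[i]^o) @ \oo --> (l : R[i]^o)) <->
  (normc (u n - l) @[n --> \oo] --> (0 : R)).
Proof.
split=> [/cvgrPdist_lt ul|ul].
  apply/cvgrPdist_lt => e e0.
  have e0C : 0 < e%:C :> R[i] by rewrite ltcR.
  near=> n.
  have : `|(l : R[i]^o) - u n| < e%:C by near: n; exact: ul.
  by rewrite distrC normCE ltcR => h; rewrite distrC subr0 ger0_norm // normc_ge0.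
apply/cvgrPdist_lt => e e0.
have /complex_realP[r er] : e \is Num.real by rewrite gtr0_real.
rewrite er in e0 *; rewrite ltcR in e0.
move/cvgrPdist_lt : ul => /(_ _ e0) ul.
near=> n.
have : `|0 - normc (u n - l)| < r by near: n; exact: ul.
by rewrite distrC subr0 [in X in _ -> X]distrC normCE ltcR ger0_norm // normc_ge0.
Unshelve. all: by end_near.
Qed.

Lemma normc_Re (z : R[i]) : `|complex.Re z| <= normc z.
Proof. by rewrite -lecR; exact: normc_ge_Re. Qed.

Lemma normc_Im (z : R[i]) : `|complex.Im z| <= normc z.
Proof. by case: z => x y /=; rewrite -sqrtr_sqr ler_wsqrtr // lerDr sqr_ge0. Qed.

Lemma normc_ReIm (z : R[i]) : normc z <= `|complex.Re z| + `|complex.Im z|.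
Proof.
rewrite -(@ler_pXn2r _ 2) ?nnegrE ?normc_ge0 ?addr_ge0 // normc_sqE.
by rewrite sqrrD !real_normK ?num_real // lerD2r lerDl mulrn_wge0 // mulr_ge0.
Qed.

Lemma ReB (z w : R[i]) : complex.Re (z - w) = complex.Re z - complex.Re w.
Proof. by case: z; case: w. Qed.

Lemma ImB (z w : R[i]) : complex.Im (z - w) = complex.Im z - complex.Im w.
Proof. by case: z; case: w. Qed.

Lemma le_normc_sum (I : Type) (r : seq I) (P : pred I) (F : I -> R[i]) :
  normc (\sum_(i <- r | P i) F i) <= \sum_(i <- r | P i) normc (F i).
Proof.
elim/big_ind2: _ => [|x a y b xa yb|//]; first by rewrite normc0.
by apply: le_trans (le_normcD _ _) _; exact: lerD.
Qed.

(** Bounded partial sums, instead of convergence of the series of norms,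
    because bounds are what comparisons of series produce. *)
Definition abs_summable (a : nat -> R[i]) : Prop :=
  exists M : R, forall n, \sum_(0 <= k < n) normc (a k) <= M.

Lemma is_cvg_normc_series (a : nat -> R[i]) :
  abs_summable a -> cvgn (series (fun n => normc (a n))).
Proof.
move=> [M aM]; apply: nondecreasing_is_cvgn.
  by apply: nondecreasing_series => n _ _; exact: normc_ge0.
by exists M => _ [n _ <-]; exact: aM.
Qed.

(** The real and imaginary parts are dominated by the norms, so that the
    completeness of [R] is enough. *)
Lemma cvg_csum (a : nat -> R[i]) :
  abs_summable a -> (series (a : nat -> R[i]^o)) @ \oo --> (csum a : R[i]^o).
Proof.
move=> /is_cvg_normc_series cva.
have cvRe : cvgn (series (fun n => complex.Re (a n))).
  apply: normed_cvg.
  by apply: (series_le_cvg _ _ _ cva) => n;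
    rewrite ?normr_ge0 ?normc_ge0 ?normc_Re.
have cvIm : cvgn (series (fun n => complex.Im (a n))).
  apply: normed_cvg.
  by apply: (series_le_cvg _ _ _ cva) => n;
    rewrite ?normr_ge0 ?normc_ge0 ?normc_Im.
set l := limn (series (fun n => complex.Re (a n))) +i*
         limn (series (fun n => complex.Im (a n))).
suff al : (series (a : nat -> R[i]^o)) @ \oo --> (l : R[i]^o).
  by rewrite /csum (cvg_lim _ al).
apply/cvg_normcP.
have ReE n : complex.Re (series a n) = series (fun n => complex.Re (a n)) n.
  by rewrite /series /= -(raddf_sum (@complex.Re R : Rcomplex R -> R)).
have ImE n : complex.Im (series a n) = series (fun n => complex.Im (a n)) n.
  by rewrite /series /= -(raddf_sum (@complex.Im R : Rcomplex R -> R)).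
apply: (@squeeze_cvgr _ _ _ _ (fun=> 0)
  (fun n => `|complex.Re (series a n) - complex.Re l| +
            `|complex.Im (series a n) - complex.Im l|)).
- apply: nearW => n; rewrite normc_ge0 /=.
  by apply: le_trans (normc_ReIm _) _; rewrite ReB ImB.
- exact: cvg_cst.
- rewrite -[0]addr0 -(normr0 R).
  apply: cvgD; apply: cvg_norm; apply/subr_cvg0.
    by rewrite (funext ReE).
  by rewrite (funext ImE).
Qed.

Lemma csum_unique (a : nat -> R[i]) l :
  (series (a : nat -> R[i]^o)) @ \oo --> (l : R[i]^o) -> csum a = l.
Proof. by move=> al; rewrite /csum (cvg_lim _ al). Qed.

Lemma abs_summableM (C : R) (a b : nat -> R[i]) :
  (forall n, normc (a n) <= C) -> abs_summable b ->
  abs_summable (fun n => a n * b n).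
Proof.
move=> aC [M bM]; have C0 : 0 <= C := le_trans (normc_ge0 _) (aC 0).
exists (C * M) => n; apply: (@le_trans _ _ (C * \sum_(0 <= k < n) normc (b k))).
  rewrite mulr_sumr; apply: ler_sum => k _.
  by rewrite normcM ler_wpM2r ?normc_ge0.
exact: ler_wpM2l.
Qed.

Lemma squeeze0 (u v : nat -> R) : (forall n, 0 <= u n <= v n) ->
  v @ \oo --> (0 : R) -> u @ \oo --> (0 : R).
Proof.
move=> uv v0; apply: (@squeeze_cvgr _ _ _ _ (fun=> 0) v) => //.
  exact: nearW.
exact: cvg_cst.
Qed.

Lemma csumZ (c : R[i]) (a : nat -> R[i]) :
  abs_summable a -> csum (fun n => c * a n) = c * csum a.
Proof.
move=> /cvg_csum/cvg_normcP acv; apply: csum_unique; apply/cvg_normcP.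
apply: (@squeeze0 _ (fun n => normc c * normc (series a n - csum a))) => [n|].
  rewrite normc_ge0 /series /= -mulr_sumr -mulrBr normcM; exact: lexx.
by rewrite -[0](mulr0 (normc c)); apply: cvgM => //; exact: cvg_cst.
Qed.

Lemma csumB (a b : nat -> R[i]) : abs_summable a -> abs_summable b ->
  csum (fun n => a n - b n) = csum a - csum b.
Proof.
move=> /cvg_csum/cvg_normcP acv /cvg_csum/cvg_normcP bcv.
apply: csum_unique; apply/cvg_normcP.
apply: (@squeeze0 _ (fun n => normc (series a n - csum a) +
    normc (series b n - csum b))) => [n|].
  rewrite normc_ge0 /series /= sumrB.
  rewrite [X in normc X](_ : _ = (series a n - csum a) - (series b n - csum b)).
    by rewrite (le_trans (le_normcD _ _)) // normcN.
  by rewrite /series /=; ring.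
by rewrite -[0]addr0; exact: cvgD.
Qed.

Lemma csum_delta (a : nat -> R[i]) n :
  csum (fun k => (k == n)%:R * a k) = a n.
Proof.
apply: csum_unique; apply: (@cvg_near_cst _ R[i]^o).
exists n.+1 => // k /= nk; rewrite /series /= (big_rem n) ?mem_index_iota //=.
rewrite eqxx mul1r big_seq big1 ?addr0 // => j.
by rewrite mem_rem_uniq ?iota_uniq // => /andP[/negPf /= ->]; rewrite mul0r.
Qed.

Lemma cvg_sum0 (f : nat -> nat -> R) K :
  (forall k, f N k @[N --> \oo] --> (0 : R)) ->
  (\sum_(0 <= k < K) f N k) @[N --> \oo] --> (0 : R).
Proof.
move=> f0; elim: K => [|K IH].
  rewrite (_ : (fun N => _) = fun=> 0); first exact: cvg_cst.
  by apply/funext => N; rewrite big_geq.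
rewrite (_ : (fun N => _) = fun N => \sum_(0 <= k < K) f N k + f N K).
  suff : (\sum_(0 <= k < K) f N k + f N K) @[N --> \oo] --> (0 + 0 : R).
    by rewrite addr0.
  exact: (cvgD IH (f0 K)).
by apply/funext => N; rewrite big_nat_recr.
Qed.

(** Dominated convergence for series (Tannery's theorem). Beyond a fixed rank
    [K] the terms contribute at most [C] times the tail of the majorant,
    whatever [N] is; the finitely many terms before [K] tend to zero. *)
Lemma csum_dominated_cvg0 (h : nat -> R[i]) (u : nat -> nat -> R[i]) (C : R) :
  abs_summable h -> (forall N n, normc (u N n) <= C) ->
  (forall n, normc (u N n) @[N --> \oo] --> (0 : R)) ->
  normc (csum (fun n => u N n * h n)) @[N --> \oo] --> (0 : R).
Proof.
move=> hs uC u0; have C0 : 0 <= C := le_trans (normc_ge0 _) (uC 0%N 0%N).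
have hcv := is_cvg_normc_series hs.
set S := limn (series (fun n => normc (h n))).
have Sle n : series (fun n => normc (h n)) n <= S.
  apply: nondecreasing_cvgn_le => //.
  by apply: nondecreasing_series => k _ _; exact: normc_ge0.
have bnd K N : normc (csum (fun n => u N n * h n)) <=
    (\sum_(0 <= k < K) normc (u N k) * normc (h k)) +
    C * (S - series (fun n => normc (h n)) K).
  have cv := cvg_csum (abs_summableM (uC N) hs).
  apply/ler_addgt0Pr => e e0.
  have /cvg_normcP/cvgrPdist_lt /(_ _ e0) [m _ mP] := cv.
  have {mP} := mP (maxn m K) (leq_maxl _ _); set p := maxn m K.
  have Kp : (K <= p)%N by exact: leq_maxr.
  rewrite sub0r normrN ger0_norm ?normc_ge0 // => pe.
  have -> : csum (fun n => u N n * h n) = series (fun n => u N n * h n) p -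
    (series (fun n => u N n * h n) p - csum (fun n => u N n * h n)).
    by rewrite opprB addrC subrK.
  apply: le_trans (le_normcD _ _) _; rewrite normcN; apply: lerD; last exact: ltW.
  rewrite /series /=; apply: le_trans (le_normc_sum _ _ _) _.
  rewrite (eq_bigr (fun k => normc (u N k) * normc (h k))) => [|k _]; last first.
    by rewrite normcM.
  rewrite (big_cat_nat (leq0n K) Kp) /= lerD2l.
  apply: (@le_trans _ _ (C * \sum_(K <= k < p) normc (h k))).
    by rewrite mulr_sumr; apply: ler_sum => k _; rewrite ler_wpM2r ?normc_ge0.
  rewrite ler_wpM2l // lerBrDl; apply: le_trans (Sle p).
  by rewrite /series /= [leRHS](big_cat_nat (leq0n K) Kp).
apply/cvgrPdist_lt => e e0.
have e2 : 0 < e / 2 by rewrite divr_gt0.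
have [K HK] : exists K, C * (S - series (fun n => normc (h n)) K) < e / 2.
  have : C * (S - series (fun n => normc (h n)) K) @[K --> \oo] --> (C * (S - S) : R).
    by apply: cvgM; [exact: cvg_cst|apply: cvgB => //; exact: cvg_cst].
  rewrite subrr mulr0 => /cvgrPdist_lt /(_ _ e2) [K _ /(_ K (leqnn K))].
  by rewrite /= sub0r normrN => /(le_lt_trans (ler_norm _)) ?; exists K.
have fin : (\sum_(0 <= k < K) normc (u N k) * normc (h k)) @[N --> \oo] --> (0 : R).
  apply: cvg_sum0 => k; rewrite -(mul0r (normc (h k))).
  exact: (cvgM (u0 k) (cvg_cst _)).
move/cvgrPdist_lt : fin => /(_ _ e2) fin.
near=> N.
rewrite sub0r normrN ger0_norm ?normc_ge0 //.
apply: le_lt_trans (bnd K N) _; rewrite [ltRHS]splitr ltrD //.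
apply: le_lt_trans (ler_norm _) _.
by rewrite -normrN -sub0r; near: N; exact: fin.
Unshelve. all: by end_near.
Qed.

Lemma csum_dominated_cvg (h : nat -> R[i]) (u : nat -> nat -> R[i])
    (v : nat -> R[i]) (C : R) :
  abs_summable h -> (forall N n, normc (u N n) <= C) ->
  (forall n, normc (u N n - v n) @[N --> \oo] --> (0 : R)) ->
  (fun N => csum (fun n => u N n * h n) : R[i]^o) @ \oo -->
    (csum (fun n => v n * h n) : R[i]^o).
Proof.
move=> hs uC uv.
have vC n : normc (v n) <= C.
  apply/ler_addgt0Pr => e e0.
  have /cvgrPdist_lt /(_ _ e0) [N _ /(_ N (leqnn N))] := uv n.
  rewrite /= sub0r normrN ger0_norm ?normc_ge0 // => Ne.
  have -> : v n = u N n - (u N n - v n) by rewrite opprB addrC subrK.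
  by apply: le_trans (le_normcD _ _) _; rewrite normcN lerD // ltW.
apply/cvg_normcP.
have -> : (fun N => normc (csum (fun n => u N n * h n) - csum (fun n => v n * h n)))
  = fun N => normc (csum (fun n => (u N n - v n) * h n)).
  apply/funext => N; rewrite -csumB; [|exact: (@abs_summableM C)..].
  by do 2!congr (_ _); apply/funext => n; rewrite mulrBl.
apply: (@csum_dominated_cvg0 _ _ (C + C)) => // N n.
by apply: le_trans (le_normcD _ _) _; rewrite normcN lerD.
Qed.

End ComplexSeries.

(** * Unit vectors and elementary operators of the Hardy space *)

Section Hardy.
Variable R : realType.
Implicit Types f g : hardy R.

Lemma is_cvg_hardy f : cvgn (series (fun n => normc (f n) ^+ 2)).
Proof. exact/asboolP/coef_square_summable. Qed.

Lemma hnorm_ge0 f : 0 <= hnorm f.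
Proof. exact: sqrtr_ge0. Qed.

Lemma series_le_hnorm f n : \sum_(0 <= k < n) normc (f k) ^+ 2 <= hnorm f ^+ 2.
Proof.
have le m : \sum_(0 <= k < m) normc (f k) ^+ 2 <=
    limn (series (fun n => normc (f n) ^+ 2)).
  apply: (@nondecreasing_cvgn_le _ (series (fun n => normc (f n) ^+ 2))).
    by apply: nondecreasing_series => k _ _; exact: sqr_ge0.
  exact: is_cvg_hardy.
rewrite sqr_sqrtr //; apply: le_trans (le 0%N).
by rewrite big_geq.
Qed.

Lemma hnorm_le f (M : R) : 0 <= M ->
  (forall n, \sum_(0 <= k < n) normc (f k) ^+ 2 <= M ^+ 2) -> hnorm f <= M.
Proof.
move=> M0 fM; rewrite -(ger0_norm M0) -sqrtr_sqr; apply: ler_wsqrtr.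
by apply: limr_le; [exact: is_cvg_hardy|apply: nearW].
Qed.

Lemma normc_le_hnorm f n : normc (f n) <= hnorm f.
Proof.
rewrite -(@ler_pXn2r _ 2) ?nnegrE ?normc_ge0 ?hnorm_ge0 //.
apply: le_trans (series_le_hnorm f n.+1).
by rewrite big_nat_recr //= lerDr sumr_ge0 // => k _; exact: sqr_ge0.
Qed.

Lemma abs_summable_hdot f g : abs_summable (fun n => f n * (g n)^*).
Proof.
exists (hnorm f ^+ 2 + hnorm g ^+ 2) => n.
apply: le_trans (lerD (series_le_hnorm f n) (series_le_hnorm g n)).
rewrite -big_split /=; apply: ler_sum => k _.
rewrite normcM [normc (g k)^*](_ : _ = normc (g k)); last first.
  by apply: complexI; exact: norm_conjC.
have := sqr_ge0 (normc (f k) - normc (g k)).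
have := normc_ge0 (f k); have := normc_ge0 (g k).
set a := normc _; set b := normc _ => *; nra.
Qed.

Let delta (m n : nat) : R[i] := (n == m)%:R.

Let sum_delta m n : \sum_(0 <= k < n) normc (delta m k) ^+ 2 <= 1.
Proof.
rewrite (eq_bigr (fun k => (k == m)%:R)) => [|k _]; last first.
  by rewrite normc_nat -natrX; case: eqP.
rewrite -natr_sum -[leRHS]/(1%:R) ler_nat -big_mkcond /= sum1_count.
by rewrite count_uniq_mem ?iota_uniq // leq_b1.
Qed.

Let delta_summable m : delta m \in square_summable R.
Proof. by apply/square_summableP; exists 1; exact: sum_delta. Qed.

Definition ebasis m : hardy R := Hardy (delta_summable m).

Lemma ebasisE m n : ebasis m n = (n == m)%:R.
Proof. by []. Qed.

Lemma hnorm_ebasis_le1 m : hnorm (ebasis m) <= 1.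
Proof. by apply: hnorm_le => // n; rewrite expr1n; exact: sum_delta. Qed.

Lemma hdot_ebasis f n : hdot f (ebasis n) = f n.
Proof.
rewrite /hdot -[RHS](csum_delta f n); congr csum; apply/funext => k.
by rewrite ebasisE rmorph_nat mulrC.
Qed.

Lemma hardyP f g : (forall n, f n = g n) -> f = g.
Proof. by move=> fg; apply: val_inj; apply/funext => n; exact: fg. Qed.

Lemma hardyD f g n : (f + g) n = f n + g n. Proof. by []. Qed.
Lemma hardyB f g n : (f - g) n = f n - g n. Proof. by []. Qed.
Lemma hardyZ c f n : (c *: f) n = c * f n. Proof. by []. Qed.
Lemma hardy_sum (I : Type) (r : seq I) (P : pred I) (F : I -> hardy R) n :
  (\sum_(i <- r | P i) F i) n = \sum_(i <- r | P i) F i n.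
Proof. by elim/big_rec2: _ => [//|i x y _ <-]. Qed.

Section Diagonal.
Variables (t : nat -> R[i]) (C : R) (tC : forall n, normc (t n) <= C).

Let C_ge0 : 0 <= C. Proof. exact: le_trans (normc_ge0 _) (tC 0%N). Qed.

Let diag_le f n :
  \sum_(0 <= k < n) normc (t k * f k) ^+ 2 <= (C * hnorm f) ^+ 2.
Proof.
rewrite exprMn; apply: le_trans (ler_wpM2l (sqr_ge0 C) (series_le_hnorm f n)).
rewrite mulr_sumr; apply: ler_sum => k _.
by rewrite normcM exprMn ler_wpM2r ?sqr_ge0 // lerXn2r ?nnegrE ?normc_ge0.
Qed.

Let diag_summable f : (fun n => t n * f n) \in square_summable R.
Proof.
by apply/square_summableP; exists ((C * hnorm f) ^+ 2); exact: diag_le.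
Qed.

Let diag_fun f : hardy R := Hardy (diag_summable f).

Let diag_linear : linear diag_fun.
Proof.
move=> c f g; apply: hardyP => n.
have E h : diag_fun h n = t n * h n by [].
by rewrite hardyD hardyZ !E hardyD hardyZ mulrDr mulrCA.
Qed.

HB.instance Definition _ :=
  GRing.isLinear.Build R[i] (hardy R) (hardy R) _ diag_fun diag_linear.

Let diag_bounded : exists M : R, forall f, hnorm (diag_fun f) <= M * hnorm f.
Proof.
exists C => f; apply: hnorm_le => [|n]; last exact: diag_le.
by rewrite mulr_ge0 ?hnorm_ge0.
Qed.

Definition diag : bounded_operator R := BoundedOperator diag_bounded.

Lemma diagE f n : diag f n = t n * f n.
Proof. by []. Qed.

End Diagonal.

Section RankOne.
Variables m n : nat.
Let rank1_fun f : hardy R := f m *: ebasis n.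

Let rank1_linear : linear rank1_fun.
Proof. by move=> c f g; rewrite /rank1_fun scalerA -scalerDl. Qed.

HB.instance Definition _ :=
  GRing.isLinear.Build R[i] (hardy R) (hardy R) _ rank1_fun rank1_linear.

Let rank1_bounded : exists M : R, forall f, hnorm (rank1_fun f) <= M * hnorm f.
Proof.
exists (hnorm (ebasis n)) => f; apply: hnorm_le => [|k].
  by rewrite mulr_ge0 ?hnorm_ge0.
rewrite exprMn mulrC.
apply: (@le_trans _ _ (normc (f m) ^+ 2 * hnorm (ebasis n) ^+ 2)).
  apply: le_trans (ler_wpM2l (sqr_ge0 _) (series_le_hnorm _ k)).
  by rewrite mulr_sumr; apply: ler_sum => j _; rewrite hardyZ normcM exprMn.
rewrite ler_wpM2r ?sqr_ge0 // lerXn2r ?nnegrE ?normc_ge0 ?hnorm_ge0 //.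
exact: normc_le_hnorm.
Qed.

Definition rank1 : bounded_operator R := BoundedOperator rank1_bounded.

Lemma rank1E f : rank1 f = f m *: ebasis n.
Proof. by []. Qed.

End RankOne.

(** A bounded operator is determined by its matrix in the basis of unit vectors,
    since the truncations of [f] converge to [f] in norm. *)
Lemma cvg_matrix_coef (T : bounded_operator R) f n :
  normc (\sum_(0 <= k < K) f k * T (ebasis k) n - T f n) @[K --> \oo] --> (0 : R).
Proof.
have [M TM] := operator_bounded T.
(* [r K] is the opposite of the tail of [f], of squared norm [tail K]. *)
pose r K := \sum_(0 <= k < K) f k *: ebasis k - f.
pose S := limn (series (fun n => normc (f n) ^+ 2)).
pose tail K := S - series (fun n => normc (f n) ^+ 2) K.
have S_le m : series (fun n => normc (f n) ^+ 2) m <= S.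
  apply: nondecreasing_cvgn_le; last exact: is_cvg_hardy.
  by apply: nondecreasing_series => k _ _; exact: sqr_ge0.
have tail_ge0 K : 0 <= tail K by rewrite subr_ge0.
have rE K k : r K k = if (k < K)%N then 0 else - f k.
  rewrite /r hardyB hardy_sum; case: ltnP => kK.
    rewrite (big_rem k) ?mem_index_iota ?kK // hardyZ ebasisE eqxx mulr1.
    rewrite big_seq big1 => [|j]; first by rewrite [X in X - _]addr0 subrr.
    rewrite mem_rem_uniq ?iota_uniq // inE => /andP[jk _].
    by rewrite hardyZ ebasisE eq_sym (negPf jk) mulr0.
  rewrite big_nat big1 ?sub0r // => j /andP[_ jK].
  by rewrite hardyZ ebasisE gtn_eqF ?mulr0 // (leq_trans jK).
have r_le K : hnorm (r K) <= Num.sqrt (tail K).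
  apply: hnorm_le => [|m]; first exact: sqrtr_ge0.
  rewrite sqr_sqrtr // /tail lerBrDl.
  apply: le_trans (S_le (maxn m K)); rewrite /series /=.
  apply: (@le_trans _ _ (series (fun n => normc (f n) ^+ 2) K +
      \sum_(0 <= k < maxn m K) normc (r K k) ^+ 2)).
    rewrite lerD2l [leRHS](big_cat_nat (leq0n m) (leq_maxl m K)) lerDl.
    by rewrite sumr_ge0 // => k _; exact: sqr_ge0.
  rewrite /series [leRHS](big_cat_nat (leq0n K) (leq_maxr m K)) lerD2l.
  rewrite (big_cat_nat (leq0n K) (leq_maxr m K)).
  rewrite big_nat big1 => [|k /andP[_ kK]]; last by rewrite rE kK normc0 expr0n.
  rewrite [leLHS]add0r le_eqVlt; apply/orP; left; apply/eqP.
  apply: eq_big_nat => k /andP[Kk _].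
  by rewrite rE ltnNge Kk normcN.
have r_bound K : normc (\sum_(0 <= k < K) f k * T (ebasis k) n - T f n) <=
    `|M| * Num.sqrt (tail K).
  have -> : \sum_(0 <= k < K) f k * T (ebasis k) n - T f n = T (r K) n.
    rewrite /r linearB hardyB linear_sum hardy_sum; congr (_ - _).
    by apply: eq_bigr => k _; rewrite linearZ.
  apply: le_trans (normc_le_hnorm _ _) _; apply: le_trans (TM _) _.
  apply: (@le_trans _ _ (`|M| * hnorm (r K))).
    by rewrite ler_wpM2r ?hnorm_ge0 ?ler_norm.
  by rewrite ler_wpM2l.
apply: (@squeeze0 _ _ (fun K => `|M| * Num.sqrt (tail K))) => [K|].
  by rewrite normc_ge0 r_bound.
have tail0 : tail K @[K --> \oo] --> (0 : R).
  rewrite -(subrr S); apply: cvgB; first exact: cvg_cst.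
  exact: is_cvg_hardy.
have sqrt0 : Num.sqrt (tail K) @[K --> \oo] --> (Num.sqrt 0 : R).
  exact: (cvg_comp _ _ tail0 (@sqrt_continuous R 0)).
rewrite -(mulr0 `|M|) -sqrtr0.
exact: (cvgM (cvg_cst _) sqrt0).
Qed.

End Hardy.

(** * Approximating indicators of single points by polynomials *)

Section Polynomials.
Variable R : realType.

Definition mean_pow (z : R[i]) N : R[i] :=
  N.+1%:R^-1 * \sum_(k < N.+1) z ^+ k.

Lemma mean_pow_le1 z N : normc z <= 1 -> normc (mean_pow z N) <= 1.
Proof.
move=> z1; rewrite normcM normcV normc_nat ler_pdivrMl ?ltr0n // mulr1.
apply: le_trans (le_normc_sum _ _ _) _.
rewrite (_ : N.+1%:R = \sum_(k < N.+1) 1); last first.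
  by rewrite sumr_const card_ord.
apply: ler_sum => k _.
by rewrite normcX exprn_ile1 // normc_ge0.
Qed.

Lemma mean_pow1 N : mean_pow 1 N = 1.
Proof.
rewrite /mean_pow (eq_bigr (fun=> 1)) => [|k _]; last by rewrite expr1n.
by rewrite sumr_const card_ord mulVf // pnatr_eq0.
Qed.

(** The geometric sum is [(z ^+ N.+1 - 1) / (z - 1)], whose numerator is
    bounded by 2. *)
Lemma cvg_mean_pow z : normc z <= 1 -> z != 1 ->
  normc (mean_pow z N) @[N --> \oo] --> (0 : R).
Proof.
move=> z1 zn1; have z10 : z - 1 != 0 by rewrite subr_eq0.
pose c := 2 * (normc (z - 1))^-1.
apply: (@squeeze0 _ _ (fun N => c * harmonic N)) => [N|]; last first.
  rewrite -(mulr0 c); exact: (cvgM (cvg_cst c) (@cvg_harmonic R)).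
rewrite normc_ge0 normcM normcV normc_nat mulrC /harmonic ler_wpM2r ?invr_ge0 //.
rewrite -[X in normc X](mulKf z10) -subrX1 normcM normcV mulrC.
rewrite ler_wpM2r ?invr_ge0 ?normc_ge0 //.
apply: le_trans (le_normcD _ _) _; rewrite normcN normc1 normcX.
by rewrite -[leRHS]/(1 + 1) lerD // exprn_ile1 // normc_ge0.
Qed.

Section Points.
Variable l : nat -> R[i].

(** Bounded pointwise limits, on the points [l n], of polynomials: for the
    diagonal operators with these entries, it implies the convergence in the
    weak operator topology. *)
Definition pointwise_approx (t : nat -> R[i]) : Prop :=
  exists (p : nat -> {poly R[i]}) (C : R),
    (forall N n, normc (p N).[l n] <= C) /\
    forall n, normc ((p N).[l n] - t n) @[N --> \oo] --> (0 : R).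

Lemma pointwise_approx0 : pointwise_approx (fun=> 0).
Proof.
exists (fun=> 0), 0; split=> [N n|n]; first by rewrite horner0 normc0.
rewrite horner0 subrr normc0; exact: cvg_cst.
Qed.

Lemma pointwise_approxD s t : pointwise_approx s -> pointwise_approx t ->
  pointwise_approx (fun n => s n + t n).
Proof.
move=> [p [C [pC ps]]] [q [D [qD qt]]].
exists (fun N => p N + q N), (C + D); split=> [N n|n].
  by rewrite hornerD (le_trans (le_normcD _ _)) // lerD.
apply: (@squeeze0 _ _ (fun N => normc ((p N).[l n] - s n) +
                                normc ((q N).[l n] - t n))) => [N|].
  by rewrite normc_ge0 hornerD opprD addrACA le_normcD.
rewrite -(addr0 (0 : R)); exact: (cvgD (ps n) (qt n)).
Qed.

Lemma pointwise_approxZ c t : pointwise_approx t ->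
  pointwise_approx (fun n => c * t n).
Proof.
move=> [p [C [pC pt]]]; exists (fun N => c *: p N), (normc c * C).
split=> [N n|n]; first by rewrite hornerZ normcM ler_wpM2l ?normc_ge0.
rewrite (_ : (fun N => _) = fun N => normc c * normc ((p N).[l n] - t n)).
  rewrite -(mulr0 (normc c)); exact: (cvgM (cvg_cst _) (pt n)).
by apply/funext => N; rewrite hornerZ -mulrBr normcM.
Qed.

Hypotheses (l_neq0 : forall n, l n != 0) (l_inj : injective l).
Hypothesis l_le : forall m n, (m <= n)%N -> normc (l n) <= normc (l m).

(** The means of the powers of [X / l m] are 1 at [l m], and they are bounded
    by 1 and tend to 0 at the later points, where the quotient lies in the closed
    unit disc and differs from 1. At the finitely many earlier points, where the
    powers may blow up, the interpolating factor [q] vanishes. *)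
Lemma pointwise_approx_delta m : pointwise_approx (fun n => (n == m)%:R).
Proof.
pose q := \prod_(j < m) ((l m - l j)^-1 *: ('X - (l j)%:P)).
pose c N := N.+1%:R^-1 *: \sum_(k < N.+1) ((l m)^-1 *: 'X) ^+ k : {poly R[i]}.
have qE n : q.[l n] = \prod_(j < m) ((l m - l j)^-1 * (l n - l j)).
  by rewrite horner_prod; apply: eq_bigr => j _; rewrite !hornerE.
have cE N n : (c N).[l n] = mean_pow (l n / l m) N.
  rewrite hornerZ horner_sum; congr (_ * _); apply: eq_bigr => k _.
  by rewrite horner_exp !hornerE mulrC.
have q_lt n : (n < m)%N -> q.[l n] = 0.
  by move=> nm; rewrite qE (bigD1 (Ordinal nm)) //= subrr mulr0 mul0r.
have qm : q.[l m] = 1.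
  rewrite qE big1 // => j _; rewrite mulVf // subr_eq0.
  by apply/eqP => /l_inj E; have := ltn_ord j; rewrite -E ltnn.
have lm0 : 0 < normc (l m).
  rewrite lt_neqAle normc_ge0 andbT eq_sym.
  by apply: contra_neq (l_neq0 m) => /eq0_normc.
have quot_le1 n : (m <= n)%N -> normc (l n / l m) <= 1.
  by move=> mn; rewrite normcM normcV ler_pdivrMr // mul1r l_le.
(* The modulus is nonincreasing, so that [l 0] has the largest one. *)
pose B := \prod_(j < m) (normc (l m - l j)^-1 * (normc (l 0%N) + normc (l j))).
have B_ge0 : 0 <= B.
  by apply: prodr_ge0 => j _; rewrite mulr_ge0 ?addr_ge0 ?normc_ge0.
have qB n : normc q.[l n] <= B.
  rewrite qE (big_morph _ (@normcM R) (@normc1 R)); apply: ler_prod => j _.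
  rewrite normc_ge0 normcM ler_wpM2l ?normc_ge0 //.
  by apply: le_trans (le_normcD _ _) _; rewrite normcN lerD2r l_le.
exists (fun N => q * c N), B; split=> [N n|n].
  rewrite hornerM normcM cE; case: (ltnP n m) => mn.
    by rewrite q_lt // normc0 mul0r.
  rewrite -[leRHS]mulr1 ler_pM ?normc_ge0 // mean_pow_le1 //; exact: quot_le1.
case: (ltngtP n m) => [nm|mn|->].
- rewrite (_ : (fun N => _) = fun=> 0); first exact: cvg_cst.
  by apply/funext => N; rewrite hornerM q_lt // mul0r subrr normc0.
- rewrite (_ : (fun N => _) = fun N => normc q.[l n] * normc (mean_pow (l n / l m) N)).
    rewrite -(mulr0 (normc q.[l n])).
    apply: (cvgM (cvg_cst _)); apply: cvg_mean_pow; first exact/quot_le1/ltnW.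
    apply/eqP => /(canRL (mulfVK (l_neq0 m))); rewrite mul1r => /l_inj nm.
    by rewrite nm ltnn in mn.
  by apply/funext => N; rewrite subr0 hornerM normcM cE.
- rewrite (_ : (fun N => _) = fun=> 0); first exact: cvg_cst.
  by apply/funext => N; rewrite hornerM cE qm divff // mean_pow1 mulr1 subrr normc0.
Qed.

Lemma pointwise_approx_finite t M :
  pointwise_approx (fun n => if (n < M)%N then t n else 0).
Proof.
elim: M => [|M IH]; first exact: pointwise_approx0.
have := pointwise_approxD IH (pointwise_approxZ (t M) (pointwise_approx_delta M)).
congr pointwise_approx; apply/funext => n.
by rewrite ltnS; case: ltngtP => [||->]; rewrite ?mulr0 ?mulr1 ?addr0 ?add0r.
Qed.

End Points.
End Polynomials.

(** * The weak operator topology *)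

Section WeakOperatorTopology.
Variable R : realType.

Lemma closure_wot_seq (S : set (bounded_operator R)) (T : bounded_operator R)
    (T_ : nat -> bounded_operator R) :
  (forall N, S (T_ N)) ->
  (forall f g, (fun N => hdot (T_ N f) g : R[i]^o) @ \oo -->
     (hdot (T f) g : R[i]^o)) ->
  closure (S : set (wot R)) T.
Proof.
move=> ST cvT B.
pose F := fun T : bounded_operator R => (fun fg => hdot (T fg.1) fg.2) :
  {ptws hardy R * hardy R -> R[i]^o}.
have FT : F \o T_ @ \oo --> F T.
  apply/cvg_sup => -[f g].
  apply/cvg_image; first by rewrite eqEsubset; split=> v // _; exists (cst v).
  move=> W /(cvT f g) WT; exists (@^~ (f, g) @^-1` W) => //.
  by rewrite eqEsubset; split => [j [? + <-//]|j Wj]; exists (fun=> j).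
rewrite nbhsE => -[_ [[U oU <-] UT] UB].
have [N _ NU] : \forall N \near \oo, U (F (T_ N)).
  by apply: FT; exact: open_nbhs_nbhs.
by exists (T_ N); split=> //; apply: UB; exact: (NU N (leqnn N)).
Qed.

Lemma near_wot (T : bounded_operator R) f g (e : R) : 0 < e ->
  \forall T' \near (T : wot R),
    normc (hdot ((T' : bounded_operator R) f) g - hdot (T f) g) < e.
Proof.
move=> e0.
have e0C : 0 < e%:C :> R[i] by rewrite ltcR.
pose F := fun T : bounded_operator R => (fun fg => hdot (T fg.1) fg.2) :
  {ptws hardy R * hardy R -> R[i]^o}.
have cF : (fun S : {ptws hardy R * hardy R -> R[i]^o} => S (f, g)) \o F
    @ (T : wot R) --> (hdot (T f) g : R[i]^o).
  apply: (@continuous_comp (wot R) _ _ F); first exact: initial_continuous.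
  exact: (@proj_continuous _ (fun=> R[i]^o) (f, g)).
move/cvgrPdist_lt : cF => /(_ _ e0C); apply: filterS => T' /=.
by rewrite distrC normCE ltcR.
Qed.

(** Matrix coefficients are weakly continuous, so that a proportionality between
    two of them passes to the closure. The factor [c] will be an eigenvalue of
    [A], to see that an operator commutes with [A], or 0, to see that it is
    diagonal. *)
Lemma closure_wot_coef (S : set (bounded_operator R)) (T : bounded_operator R)
    f g m n (c : R[i]) :
  (forall T' : bounded_operator R, S T' -> T' f m = c * T' g n) ->
  closure (S : set (wot R)) T -> T f m = c * T g n.
Proof.
move=> Sc clT; apply/eqP; rewrite -subr_eq0; apply/eqP/eq0_normc/eqP.
rewrite eq_le normc_ge0 andbT; apply/ler_addgt0Pr => e e0; rewrite add0r.
have c1 : 0 < 1 + normc c by rewrite ltr_pwDl ?normc_ge0.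
have d0 : 0 < e / (1 + normc c) by rewrite divr_gt0.
have [T' [ST' []]] := clT _ (filterI (near_wot T f (ebasis R m) d0)
  (near_wot T g (ebasis R n) d0)).
rewrite /= !hdot_ebasis => fm gn.
have -> : T f m - c * T g n = c * (T' g n - T g n) - (T' f m - T f m).
  by rewrite (Sc _ ST'); ring.
apply: le_trans (le_normcD _ _) _; rewrite normcN normcM.
rewrite [leRHS](_ : e = normc c * (e / (1 + normc c)) + e / (1 + normc c)).
  by apply: lerD; rewrite ?ler_wpM2l ?normc_ge0 // ltW.
by field; rewrite lt0r_neq0.
Qed.

End WeakOperatorTopology.

(** * Diagonal operators with a minimal commutant *)

Section DiagonalOperator.
Variables (R : realType) (A : bounded_operator R) (l : nat -> R[i]).
Hypothesis AE : forall f n, A f n = l n * f n.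

Lemma iter_diagE k f n : iter k A f n = l n ^+ k * f n.
Proof. by elim: k => [|k IH]; rewrite ?mul1r // iterS AE IH exprS mulrA. Qed.

Lemma poly_diagE (p : {poly R[i]}) f n :
  (\sum_(k < size p) p`_k *: iter k A f) n = p.[l n] * f n.
Proof.
rewrite hardy_sum horner_coef mulr_suml; apply: eq_bigr => k _.
by rewrite hardyZ iter_diagE mulrA.
Qed.

Lemma alg_coef T : alg A T ->
  exists t : nat -> R[i], forall f n, T f n = t n * f n.
Proof.
by move=> [p Tp]; exists (fun n => p.[l n]) => f n; rewrite Tp poly_diagE.
Qed.

Lemma closure_alg_commutant : closure (alg A : set (wot R)) `<=` commutant A.
Proof.
move=> T clT f; apply: hardyP => n; rewrite AE.
apply: closure_wot_coef clT => T' /alg_coef[t T't].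
by rewrite !T't AE mulrCA.
Qed.

(** The polynomials in [A] are diagonal, and this is a closed condition. *)
Lemma closure_alg_ebasis T m n : m != n -> closure (alg A : set (wot R)) T ->
  T (ebasis R m) n = 0.
Proof.
move=> mn clT; rewrite -(mul0r (T (ebasis R m) n)).
apply: closure_wot_coef clT => T' /alg_coef[t T't].
by rewrite T't ebasisE eq_sym (negPf mn) mulr0 mul0r.
Qed.

Lemma rank1_commutant m n : l m = l n -> commutant A (rank1 R m n).
Proof.
move=> lmn f; apply: hardyP => k; rewrite AE !rank1E !hardyZ AE ebasisE.
by case: eqP => [->|_]; rewrite ?mulr0 ?mulr1 ?lmn.
Qed.

(** A repeated eigenvalue produces an operator of rank one that commutes with
    [A] and is not diagonal. *)
Lemma minimal_commutant_inj : has_minimal_commutant A -> injective l.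
Proof.
move=> minA m n lmn; apply/eqP; apply: contraT => mn.
have : closure (alg A : set (wot R)) (rank1 R m n).
  by rewrite minA; exact: rank1_commutant.
move/(closure_alg_ebasis mn)/eqP.
by rewrite rank1E hardyZ !ebasisE !eqxx mulr1 oner_eq0.
Qed.

Hypothesis l_inj : injective l.

(** The unit vectors are eigenvectors with distinct eigenvalues, so the matrix
    of an operator that commutes with [A] is diagonal. *)
Lemma commutant_diag T : commutant A T ->
  forall f n, T f n = T (ebasis R n) n * f n.
Proof.
move=> TA f n.
have off k : k != n -> T (ebasis R k) n = 0.
  move=> kn; have : T (A (ebasis R k)) n = A (T (ebasis R k)) n by rewrite TA.
  have -> : A (ebasis R k) = l k *: ebasis R k.
    apply: hardyP => j; rewrite AE hardyZ ebasisE.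
    by case: eqP => [->|_]; rewrite ?mulr0.
  rewrite linearZ hardyZ AE => /eqP; rewrite -subr_eq0 -mulrBl mulf_eq0 subr_eq0.
  by case/orP => [/eqP/l_inj/eqP|/eqP //]; rewrite (negPf kn).
have := cvg_matrix_coef T f n => cv.
have {}cv : normc (T (ebasis R n) n * f n - T f n) @[K --> \oo] --> (0 : R).
  apply: cvg_trans cv; apply: near_eq_cvg; exists n.+1 => // K /= nK.
  rewrite (big_rem n) ?mem_index_iota //= big_seq big1 => [|k].
    by rewrite [X in normc (X - _)]addr0 mulrC.
  by rewrite mem_rem_uniq ?iota_uniq // inE => /andP[/off -> _]; rewrite mulr0.
have /eq0_normc/eqP : normc (T (ebasis R n) n * f n - T f n) = 0.
  by rewrite -(cvg_lim (@norm_hausdorff _ R^o) cv) lim_cst.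
by rewrite subr_eq0 => /eqP.
Qed.

Hypotheses (l_neq0 : forall n, l n != 0)
  (l_le : forall m n, (m <= n)%N -> normc (l n) <= normc (l m)).

Lemma cvg_hdot_diag (t_ : nat -> nat -> R[i]) (t : nat -> R[i]) (C : R)
    (T_ : nat -> bounded_operator R) (T : bounded_operator R) :
  (forall N f n, T_ N f n = t_ N n * f n) -> (forall f n, T f n = t n * f n) ->
  (forall N n, normc (t_ N n) <= C) ->
  (forall n, normc (t_ N n - t n) @[N --> \oo] --> (0 : R)) ->
  forall f g, (fun N => hdot (T_ N f) g : R[i]^o) @ \oo -->
    (hdot (T f) g : R[i]^o).
Proof.
move=> T_E TE tC tt f g.
rewrite (_ : (fun N => _) = fun N => csum (fun n => t_ N n * (f n * (g n)^*))).
  rewrite (_ : hdot _ _ = csum (fun n => t n * (f n * (g n)^*))).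
    exact: (csum_dominated_cvg (abs_summable_hdot f g) tC tt).
  by congr csum; apply/funext => n; rewrite TE mulrA.
by apply/funext => N; congr csum; apply/funext => n; rewrite T_E mulrA.
Qed.

Lemma pointwise_approx_closure t (T : bounded_operator R) :
  pointwise_approx l t -> (forall f n, T f n = t n * f n) ->
  closure (alg A : set (wot R)) T.
Proof.
move=> [p [C [pC pt]]] TE.
apply: (@closure_wot_seq _ _ _ (fun N => diag (pC N))).
  by move=> N; exists (p N) => f; apply: hardyP => n; rewrite poly_diagE.
exact: (@cvg_hdot_diag (fun N n => (p N).[l n]) t C).
Qed.

(** A diagonal operator is the weak limit of its finite truncations, which are
    themselves weak limits of polynomials in [A]; a closure is closed, so the
    two limits need not be merged into one. *)
Lemma inj_minimal_commutant : has_minimal_commutant A.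
Proof.
apply/seteqP; split; first exact: closure_alg_commutant.
move=> T TA; have TE := commutant_diag TA.
set t := fun n => T (ebasis R n) n in TE.
have [M TM] := operator_bounded T.
pose C := `|M|.
have tC n : normc (t n) <= C.
  apply: le_trans (normc_le_hnorm _ _) _; apply: le_trans (TM _) _.
  rewrite -[leRHS]mulr1; apply: (@le_trans _ _ (C * hnorm (ebasis R n))).
    by rewrite ler_wpM2r ?hnorm_ge0 ?ler_norm.
  by rewrite ler_wpM2l ?hnorm_ebasis_le1 /C.
pose tr K n := if (n < K)%N then t n else 0.
have trC K n : normc (tr K n) <= C.
  by rewrite /tr; case: ifP => _; rewrite ?normc0 /C.
rewrite ((closure_id (closure (alg A : set (wot R)))).1 (@closed_closure _ _)).
apply: (@closure_wot_seq _ _ _ (fun K => diag (trC K))).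
  move=> K; apply: (@pointwise_approx_closure (tr K)) => //.
  exact: pointwise_approx_finite.
apply: (@cvg_hdot_diag tr t C) => // n.
apply: cvg_near_cst; exists n.+1 => // K /= nK.
by rewrite /tr nK subrr normc0.
Qed.

End DiagonalOperator.

(** * Translations act diagonally on Dirichlet series *)

Section Dirichlet.
Variable R : realType.

Lemma natcpow_natN n j : natcpow n.+1 (- j%:R) = n.+1%:R^-1 ^+ j :> R[i].
Proof.
elim: j => [|j IH].
  by rewrite expr0 oppr0 /natcpow mul0r /cexp /= expR0 cos0 sin0 mul1r.
rewrite exprS -IH -natr1 opprD addrC natcpowD; congr (_ * _).
rewrite /natcpow mulN1r /cexp /= oppr0 cos0 sin0 expRN lnK ?posrE ?ltr0n //.
by rewrite mulr1 rmorphV ?unitfE ?pnatr_eq0 //= rmorph_nat.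
Qed.

(** The bound telescopes, because [1 / (n + 1) ^ 2 <= 1 / n - 1 / (n + 1)]
    when [n] is positive. *)
Lemma sum_inv_sqr n : \sum_(0 <= k < n.+1) (k.+1%:R^-1 ^+ 2 : R) <= 2 - n.+1%:R^-1.
Proof.
elim: n => [|n IH]; first by rewrite big_nat1 invr1 expr1n; lra.
rewrite big_nat_recr //=; apply: le_trans (lerD IH (lexx _)) _.
have n0 : 0 < n.+1%:R :> R by rewrite ltr0n.
rewrite -(natr1 n.+1); set x := n.+1%:R in n0 *.
rewrite -subr_ge0 [leRHS](_ : _ = (x * (x + 1) ^+ 2)^-1); last by field; lra.
by rewrite invr_ge0 mulr_ge0 ?sqr_ge0 ?ltW.
Qed.

Lemma abs_summable_dirichlet (f : hardy R) j :
  abs_summable (fun n => f n * n.+1%:R^-1 ^+ j.+2).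
Proof.
apply: (@abs_summableM _ (hnorm f)) => [n|]; first exact: normc_le_hnorm.
exists 2 => -[|n]; first by rewrite big_geq.
apply: le_trans (le_trans (sum_inv_sqr n) _); last by rewrite gerBl invr_ge0.
apply: ler_sum => k _; rewrite normcX normcV normc_nat -addn2 exprD.
rewrite ler_piMl ?sqr_ge0 // exprn_ile1 ?invr_ge0 //.
by rewrite invf_le1 ?ltr0n // ler1n.
Qed.

Lemma dirichlet_nat (f : hardy R) j :
  dirichlet f j%:R = csum (fun n => f n * n.+1%:R^-1 ^+ j).
Proof. by congr csum; apply/funext => n; rewrite natcpow_natN. Qed.

(** The first nonzero coefficient [d n] of the difference of the two series
    would be the limit of [(n + 1) ^ s] times the value of that difference at
    [s], as [s] tends to infinity; the integers [s = N + 2] suffice, and the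
    exponent 2 provides the summable majorant. *)
Lemma dirichlet_inj (f g : hardy R) :
  (forall s : R[i], 2^-1 < complex.Re s -> dirichlet f s = dirichlet g s) ->
  f = g.
Proof.
move=> fg; apply/eqP; rewrite -subr_eq0; apply/eqP; set d := f - g.
have d0 j : csum (fun n => d n * n.+1%:R^-1 ^+ j.+2) = 0.
  transitivity (dirichlet f j.+2%:R - dirichlet g j.+2%:R); last first.
    rewrite fg ?subrr // -(rmorph_nat (real_complex R)) /=.
    by rewrite -(natr1 j.+1) -(natr1 j); have := ler0n R j; lra.
  rewrite !dirichlet_nat -csumB; [|exact: abs_summable_dirichlet..].
  by congr csum; apply/funext => n; rewrite hardyB mulrBl.
apply: hardyP => n; rewrite [RHS]/=.
elim/ltn_ind: n => n IH.
pose h k := d k * k.+1%:R^-1 ^+ 2.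
pose u N k : R[i] := if (k < n)%N then 0 else (n.+1%:R / k.+1%:R) ^+ N.
have ratio k : normc (n.+1%:R / k.+1%:R : R[i]) = n.+1%:R / k.+1%:R.
  by rewrite normcM normcV !normc_nat.
have u1 N k : normc (u N k) <= 1.
  rewrite /u; case: ltnP => nk; first by rewrite normc0.
  rewrite normcX ratio exprn_ile1 ?divr_ge0 //.
  by rewrite ler_pdivrMr ?ltr0n // mul1r ler_nat.
have udelta k : normc (u N k - (k == n)%:R) @[N --> \oo] --> (0 : R).
  rewrite /u; case: (ltngtP k n) => [_|nk|->].
  - by rewrite subrr normc0; exact: cvg_cst.
  - rewrite (_ : (fun N => _) = fun N => (n.+1%:R / k.+1%:R) ^+ N); last first.
      by apply/funext => N; rewrite subr0 normcX ratio.
    apply: cvg_expr; rewrite ger0_norm ?divr_ge0 //.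
    by rewrite ltr_pdivrMr ?ltr0n // mul1r ltr_nat.
  - rewrite (_ : (fun N => _) = fun=> 0); first exact: cvg_cst.
    by apply/funext => N; rewrite divff ?pnatr_eq0 // expr1n subrr normc0.
have hs := abs_summable_dirichlet d 0.
have := csum_dominated_cvg hs u1 udelta; rewrite csum_delta => /cvg_normcP.
rewrite (_ : (fun N => _) = fun=> normc (h n)) => [cv|]; last first.
  apply/funext => N; rewrite (_ : csum _ = 0) ?sub0r ?normcN //.
  rewrite (_ : (fun k => _) =
      fun k => n.+1%:R ^+ N * (d k * k.+1%:R^-1 ^+ N.+2)).
    by rewrite csumZ ?d0 ?mulr0 //; exact: abs_summable_dirichlet.
  apply/funext => k; rewrite /u /h; case: ltnP => [/IH ->|_].
    by rewrite !mul0r mulr0.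
  by rewrite exprMn -(addn2 N) exprD; ring.
have /eq0_normc/eqP : normc (h n) = 0.
  by rewrite -(cvg_lim (@norm_hausdorff _ R^o) cv) lim_cst.
by rewrite /h mulf_eq0 expf_eq0 invr_eq0 pnatr_eq0 orbF => /eqP.
Qed.

Section Translation.
Variables (c : R[i]) (c_ge0 : 0 <= complex.Re c).

(** [composition_operator] is specified by the values of the functions only;
    the uniqueness of Dirichlet coefficients gives its action on
    coefficients. *)
Lemma translationE f n :
  composition_operator (fun s => s + c) f n = natcpow n.+1 (- c) * f n.
Proof.
have l1 k := normc_natcpowN_le1 k c_ge0.
suff -> : composition_operator (fun s => s + c) f = diag l1 f by rewrite diagE.
apply: dirichlet_inj => s s_gt.
rewrite (composition_operator_translationP c_ge0) //.
congr csum; apply/funext => k; rewrite diagE opprD addrC natcpowD.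
by rewrite mulrCA mulrA.
Qed.

Lemma normc_natcpowN n :
  normc (natcpow n.+1 (- c)) = expR (- (complex.Re c * ln n.+1%:R)).
Proof.
by rewrite normc_cexp; congr expR; case: c => x y /=; ring.
Qed.

Lemma natcpowN_neq0 n : natcpow n.+1 (- c) != 0.
Proof.
by apply/eqP => E; have := expR_gt0 (- (complex.Re c * ln n.+1%:R));
  rewrite -normc_natcpowN E normc0 ltxx.
Qed.

Lemma normc_natcpowN_le m n : (m <= n)%N ->
  normc (natcpow n.+1 (- c)) <= normc (natcpow m.+1 (- c)).
Proof.
move=> mn; rewrite !normc_natcpowN ler_expR lerN2 ler_wpM2l //.
rewrite ler_ln ?posrE ?ltr0n //.
by rewrite ler_nat ltnS.
Qed.

End Translation.

End Dirichlet.

(** * Coincidences among the powers of the integers *)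

Section Coincidences.
Variable R : realType.

Lemma cos_sin_2kpi (x : R) (k : int) :
  cos (x + 2 * k%:~R * pi) = cos x /\ sin (x + 2 * k%:~R * pi) = sin x.
Proof.
have E n : 2 * n%:R * pi = pi *+ 2 *+ n :> R.
  by rewrite -mulr_natl -[X in _ = X]mulr_natr; ring.
case: k => n.
  rewrite -pmulrn E; split; first exact: (periodicn (@cosD2pi R)).
  exact: (periodicn (@sinD2pi R)).
rewrite NegzE mulrNz -pmulrn mulrN mulNr E.
split; first by rewrite -(periodicn (@cosD2pi R) n.+1 (x - _)) subrK.
by rewrite -(periodicn (@sinD2pi R) n.+1 (x - _)) subrK.
Qed.

(** Subtract the multiple of [2 * pi] given by the floor: half of the remainder
    is nonnegative and less than [pi], where the sine vanishes only at 0. *)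
Lemma cos_eq1 (x : R) : cos x = 1 -> exists k : int, x = 2 * k%:~R * pi.
Proof.
move=> cx1; have pi2 : 0 < 2 * pi :> R by rewrite mulr_gt0 ?pi_gt0.
pose k := Num.floor (x / (2 * pi)); exists k.
have /andP[kx xk] := floor_itv (x / (2 * pi)).
pose y := (x - 2 * k%:~R * pi) / 2.
have y_ge0 : 0 <= y.
  rewrite divr_ge0 // subr_ge0 mulrAC -ler_pdivlMl // mulrC; exact: kx.
have y_lt : y < pi.
  move: xk; rewrite ltr_pdivrMr // intrD /y -/k; nra.
have cy : cos (y *+ 2) = 1.
  rewrite -(cos_sin_2kpi (y *+ 2) k).1 -[RHS]cx1; congr cos.
  by rewrite /y -mulr_natr; field.
have sy : sin y = 0.
  apply/eqP; rewrite -sqrf_eq0 sin2cos2; move: cy; rewrite cos_mulr2n => cy.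
  by apply/eqP; lra.
case: (ltgtP 0 y) => [y0|y0|y0].
- by have := sin_gt0_pi (introT andP (conj y0 y_lt)); rewrite sy ltxx.
- by rewrite ltNge y_ge0 in y0.
- move: y0; rewrite /y => /eqP; rewrite eq_sym mulf_eq0 invr_eq0 pnatr_eq0.
  by rewrite orbF subr_eq0 => /eqP.
Qed.

Lemma natcpow_imag (tau : R) m : natcpow m (- ('i * tau%:C)) =
  cos (tau * ln m%:R) +i* (- sin (tau * ln m%:R)).
Proof.
rewrite /natcpow /cexp; set z := _ * (ln _)%:C.
have -> : complex.Re z = 0 by rewrite /z /=; ring.
have -> : complex.Im z = - (tau * ln m%:R) by rewrite /z /=; ring.
by rewrite expR0 mul1r cosN sinN.
Qed.

(** Comparing moduli, a coincidence [(m + 1) ^ (- c) = (n + 1) ^ (- c)] with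
    [m != n] forces [c] to be purely imaginary; comparing arguments,
    [Im c * ln ((m + 1) / (n + 1))] is then a nonzero multiple of
    [2 * pi]. *)
Lemma natcpowN_injP (c : R[i]) : c != 0 ->
  injective (fun n => natcpow n.+1 (- c)) <->
  ~ (exists tau : R, c = 'i * tau%:C /\
      exists (k : int) (m0 n0 : nat),
        [/\ k != 0, (1 <= m0)%N, (1 <= n0)%N, m0 != n0 &
            tau = 2 * k%:~R * pi / ln (m0%:R / n0%:R)]).
Proof.
move=> c0; split=> [inj [tau [cE [k [m0 [n0 [_ m0_gt0 n0_gt0 mn tauE]]]]]]|nex m n lmn].
  case: m0 m0_gt0 mn tauE => // m _; case: n0 n0_gt0 => // n _ mn tauE.
  have lnmn : ln (m.+1%:R / n.+1%:R) != 0 :> R.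
    apply: contraNneq mn => /eqP; rewrite ln_eq0 ?divr_gt0 ?ltr0n //.
    move=> /eqP/divr1_eq/eqP.
    by rewrite eqr_nat.
  suff /inj nm : natcpow m.+1 (- c) = natcpow n.+1 (- c) by rewrite nm eqxx in mn.
  rewrite cE !natcpow_imag.
  have -> : tau * ln m.+1%:R = tau * ln n.+1%:R + 2 * k%:~R * pi.
    have : tau * ln (m.+1%:R / n.+1%:R) = 2 * k%:~R * pi by rewrite tauE divfK.
    rewrite ln_div ?posrE ?ltr0n // => <-; ring.
  by have [-> ->] := cos_sin_2kpi (tau * ln n.+1%:R) k.
apply/eqP; apply: contraT => mn; exfalso; apply: nex.
have lnmn : ln m.+1%:R - ln n.+1%:R != 0 :> R.
  rewrite subr_eq0; apply: contra_neq mn => /ln_inj.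
  rewrite !posrE !ltr0n => /(_ isT isT)/eqP; rewrite eqr_nat => /eqP[]; exact.
have Rec0 : complex.Re c = 0.
  have := congr1 (@normc R) lmn; rewrite !normc_natcpowN => /expR_inj/oppr_inj/eqP.
  by rewrite -subr_eq0 -mulrBr mulf_eq0 (negPf lnmn) orbF => /eqP.
have cE : c = 'i * (complex.Im c)%:C by rewrite [LHS]complexE Rec0 rmorph0 add0r.
set tau := complex.Im c in cE.
have tau0 : tau != 0 by apply: contra_neq c0 => t0; rewrite cE t0 rmorph0 mulr0.
exists tau; split => //.
have [k kE] : exists k : int, tau * (ln m.+1%:R - ln n.+1%:R) = 2 * k%:~R * pi.
  apply: cos_eq1; rewrite mulrBr cosB; move: lmn; rewrite cE !natcpow_imag.
  by move=> [-> /oppr_inj ->]; rewrite -!expr2 cos2Dsin2.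
exists k, m.+1, n.+1; split=> //.
- apply/eqP => k0; move: kE; rewrite k0 mulr0 mul0r => /eqP.
  by rewrite mulf_eq0 (negPf tau0) (negPf lnmn).
- by rewrite ln_div ?posrE ?ltr0n // -kE mulfK.
Qed.

End Coincidences.

Theorem corollary5p5 (R : realType) (c1 : R[i])
    (c1_ge0 : 0 <= complex.Re c1) (c1_neq0 : c1 != 0) :
  has_minimal_commutant (composition_operator (fun s : R[i] => s + c1)) <->
  ~ (exists tau : R, c1 = 'i * tau%:C /\
      exists (k : int) (m0 n0 : nat),
        [/\ k != 0, (1 <= m0)%N, (1 <= n0)%N, m0 != n0 &
            tau = 2 * k%:~R * pi / ln (m0%:R / n0%:R)]).
Proof.
have AE := translationE c1_ge0.
apply: iff_trans (natcpowN_injP c1_neq0); split.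
  exact: (minimal_commutant_inj AE).
move=> inj; apply: (inj_minimal_commutant AE inj).
  exact: natcpowN_neq0.
exact: normc_natcpowN_le.
Qed.
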